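(* Let $g:\mathbb{R}^n\to\mathbb{R}\cup\{+\infty\}$ be an essentially smooth l.s.c. proper convex function. If $f:\mathbb{R}^n\to\overline{\mathbb{R}}$ is a l.s.c. function such that $f^\star\leq g$ and $f^\star(x)=g(x)$ for all $x\in\mathrm{idom}(g)$, then $f=g^\star$. In particular, $g$ has a unique preimage by the Legendre-Fenchel transform (among l.s.c. functions $\mathbb{R}^n\to\overline{\mathbb{R}}$).
   Context: $\overline{\mathbb{R}}=\mathbb{R}\cup\{\pm\infty\}$. The Legendre-Fenchel transform of $f:\mathbb{R}^n\to\overline{\mathbb{R}}$ is $f^\star(x)=\sup_{y\in\mathbb{R}^n}(\langle x,y\rangle-f(y))$, with values in $\overline{\mathbb{R}}$; in the setting of the paper it is viewed as a map defined on the set of l.s.c. functions from $\mathbb{R}^n$ to $\overline{\mathbb{R}}$. A function is proper if it never takes the value $-\infty$ and is not identically $+\infty$. $\mathrm{dom}(g)=\{x\mid -\infty<g(x)<+\infty\}$ and $\mathrm{idom}(g)=\{x\in\mathrm{dom}(g)\mid\limsup_{x'\to x}g(x')<+\infty\}$ (for l.s.c. proper convex $g$ on $\mathbb{R}^n$ this is the interior of $\mathrm{dom}(g)$). A l.s.c. proper convex function $g$ on $\mathbb{R}^n$ is essentially smooth if $\mathrm{idom}(g)\neq\emptyset$, $g$ is differentiable in $\mathrm{idom}(g)$, and the norm of the differential of $g$ at $x\in\mathrm{idom}(g)$ tends to infinity when $x$ goes to the boundary of $\mathrm{dom}(g)$ (i.e. $\|\nabla g(x_k)\|\to\infty$ for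 every sequence $(x_k)$ in $\mathrm{idom}(g)$ converging to a boundary point of $\mathrm{dom}(g)$). *)

(* Defs.v *)
From HB Require Import structures.
From mathcomp Require Import all_boot all_order all_algebra.
From mathcomp Require Import all_classical all_reals all_analysis.

Set Implicit Arguments.
Unset Strict Implicit.
Unset Printing Implicit Defensive.

Import Order.TTheory GRing.Theory Num.Theory.
Import numFieldNormedType.Exports.

Local Open Scope classical_set_scope.
Local Open Scope ring_scope.

Section Defs.
Variables (R : realType) (n : nat).
Implicit Types (f g : 'rV[R]_n -> \bar R) (x y : 'rV[R]_n).

Definition dotv x y : R := \sum_(i < n) x ord0 i * y ord0 i.

Definition legendre f x : \bar R :=
  ereal_sup (range (fun y => (dotv x y)%:E - f y)%E).

Definition proper_efun f : Prop :=
  (forall x, f x != -oo%E) /\ (exists x, f x != +oo%E).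

(* Meant for functions that never take the value -oo, so that the right-hand
   side is never +oo - oo; recall that 0 * +oo = 0 in \bar R. *)
Definition convex_efun g : Prop :=
  forall x y (t : R), 0 <= t -> t <= 1 ->
    (g (t *: x + (1 - t) *: y)%R <= t%:E * g x + (1 - t)%R%:E * g y)%E.

Definition dom g : set 'rV[R]_n := [set x | -oo < g x < +oo]%E.

(* The limsup is over full, not punctured, neighbourhoods of x. *)
Definition idom g : set 'rV[R]_n :=
  [set x | dom g x /\ (limf_esup g (nbhs x) < +oo)%E].

Definition boundary (A : set 'rV[R]_n) : set 'rV[R]_n :=
  closure A `\` interior A.

(* The library's norm on 'rV[R]_n is the max norm; this is the Euclidean one. *)
Definition enorm x : R := Num.sqrt (dotv x x).

(* A proper g is finite near every point of idom g, so there its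
   differentiability is that of the real-valued function fine \o g. *)
Definition gradient g x : 'rV[R]_n :=
  \row_(i < n) ('d (fine \o g) x (delta_mx ord0 i) : R).

Definition essentially_smooth g : Prop :=
  [/\ idom g !=set0,
      forall x, idom g x -> differentiable (fine \o g) x
    & forall (u : nat -> 'rV[R]_n) (b : 'rV[R]_n),
        (forall k, idom g (u k)) -> boundary (dom g) b ->
        u k @[k --> \oo] --> b ->
        enorm (gradient g (u k)) @[k --> \oo] --> +oo].

End Defs.

(* Main.v *)
Require Import Defs.
From HB Require Import structures.
From mathcomp Require Import all_boot all_order all_algebra.
From mathcomp Require Import all_classical all_reals all_analysis.
From mathcomp Require Import ring lra.

Import Order.TTheory GRing.Theory Num.Theory.
Import numFieldNormedType.Exports.

(* The inequality g^* <= f is formal. For f y <= g^* y, minimise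
   g + e/2 |.|^2 - <., y>: the minimiser z has y - e z as a subgradient of g,
   so z lies in idom g by essential smoothness and grad g z = y - e z. At a
   point of idom g where f^* = g, near-maximisers of <z, .> - f converge to
   grad g z, so lower semicontinuity gives
   f (y - e z) <= <z, y - e z> - g z <= g^* y, and e z -> 0 as e -> 0. The same
   minimisation with a large quadratic term gives g^** = g, the affine minorant
   of g being a tangent at a point of idom g. *)

Section LegendreFenchel.
Set Implicit Arguments.
Unset Strict Implicit.
Unset Printing Implicit Defensive.
Local Open Scope classical_set_scope.
Local Open Scope ring_scope.
Variables (R : realType) (n : nat).
Implicit Types (x y z w h p q : 'rV[R]_n) (f g : 'rV[R]_n -> \bar R).

(** * Inner product, max norm and Euclidean norm *)

Lemma dotvC x y : dotv x y = dotv y x.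
Proof. by apply: eq_bigr => i _; rewrite mulrC. Qed.

Lemma dotvDl x y z : dotv (x + y) z = dotv x z + dotv y z.
Proof. by rewrite -big_split; apply: eq_bigr => i _; rewrite mxE mulrDl. Qed.

Lemma dotvZl a x y : dotv (a *: x) y = a * dotv x y.
Proof. by rewrite mulr_sumr; apply: eq_bigr => i _; rewrite mxE mulrA. Qed.

Lemma dotvNl x y : dotv (- x) y = - dotv x y.
Proof. by rewrite -scaleN1r dotvZl mulN1r. Qed.

Lemma dotvDr x y z : dotv x (y + z) = dotv x y + dotv x z.
Proof. by rewrite dotvC dotvDl !(dotvC x). Qed.

Lemma dotvZr a x y : dotv x (a *: y) = a * dotv x y.
Proof. by rewrite dotvC dotvZl dotvC. Qed.

Lemma dotvNr x y : dotv x (- y) = - dotv x y.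
Proof. by rewrite dotvC dotvNl dotvC. Qed.

Definition dotvE := (dotvDl, dotvDr, dotvNl, dotvNr, dotvZl, dotvZr).

Lemma dotv_delta x i : dotv x (delta_mx ord0 i) = x ord0 i.
Proof.
rewrite /dotv (bigD1 i)//= mxE !eqxx mulr1 big1 ?addr0// => j ji.
by rewrite mxE (negbTE ji) andbF mulr0.
Qed.

Lemma dotvv_ge0 x : 0 <= dotv x x.
Proof. by apply: sumr_ge0 => i _; rewrite -expr2 sqr_ge0. Qed.

Lemma dotv_le_half x y : dotv x y <= (dotv x x + dotv y y) / 2.
Proof. by have := dotvv_ge0 (x - y); rewrite !dotvE (dotvC y x); lra. Qed.

Lemma ler_coord_norm x i : `|x ord0 i| <= `|x|.
Proof.
rewrite [leRHS]/Num.norm/= mx_normrE.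
by apply/bigmax_geP; right => /=; exists (ord0, i).
Qed.

Lemma normv_le x a : 0 <= a -> (forall i, `|x ord0 i| <= a) -> `|x| <= a.
Proof.
move=> a0 xa; rewrite [leLHS]/Num.norm/= mx_normrE.
by apply/bigmax_leP; split => // -[i j] _ /=; rewrite (ord1 i).
Qed.

Lemma normv_sqr_le x : `|x| ^+ 2 <= dotv x x.
Proof.
have xx := dotvv_ge0 x.
suff : `|x| <= Num.sqrt (dotv x x).
  by rewrite -[X in _ -> _ <= X]sqr_sqrtr// ler_sqr// nnegrE.
apply: normv_le => // i; rewrite -sqrtr_sqr ler_wsqrtr//.
rewrite /dotv (bigD1 i)//= expr2 lerDl.
by apply: sumr_ge0 => j _; rewrite -expr2 sqr_ge0.
Qed.

(** Each of the [n] products is at most [|x| * |y|]; the factor [n] is the price of the max norm in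
    Cauchy-Schwarz. *)
Lemma dotv_le_norm x y : `|dotv x y| <= n%:R * `|x| * `|y|.
Proof.
apply: le_trans (ler_norm_sum _ _ _) _.
rewrite -mulrA mulr_natl -[X in _ *+ X]card_ord -sumr_const.
by apply: ler_sum => i _; rewrite normrM ler_pM// ler_coord_norm.
Qed.

(** Testing with plus and minus [r] times each basis vector bounds every coordinate of [q]. *)
Lemma normv_dual_le q (r a : R) : 0 < r -> 0 <= a ->
  (forall h, `|h| <= r -> dotv h q <= a * r) -> `|q| <= a.
Proof.
move=> r0 a0 hq; apply: normv_le => // i.
have di (b : R) : `|b| = 1 -> `|(b * r) *: delta_mx ord0 i : 'rV[R]_n| <= r.
  move=> b1; rewrite normrZ normrM b1 mul1r (gtr0_norm r0).
  rewrite ler_piMr ?(ltW r0)//; apply: normv_le => // j.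
  by rewrite mxE; case: (_ && _); rewrite ?normr1 ?normr0.
have := hq _ (di 1 (normr1 _)); have := hq _ (di (-1) (normrN1 _)).
rewrite !dotvZl (dotvC _ q) dotv_delta => h1 h2.
have {}h1 : - q ord0 i <= a by rewrite -(ler_pM2r r0); lra.
have {}h2 : q ord0 i <= a by rewrite -(ler_pM2r r0); lra.
by rewrite ler_norml; apply/andP; split; lra.
Qed.

(** The test vector is [q] rescaled to Euclidean length [r]; it lies in the max-norm ball because
    the max norm is the smaller one. *)
Lemma enorm_dual_le q (r C : R) : 0 < r ->
  (forall h, `|h| <= r -> dotv q h <= C) -> enorm q * r <= C.
Proof.
move=> r0 hq; have C0 : 0 <= C.
  have := hq 0; rewrite normr0 -(scale0r q) dotvZr mul0r; apply; exact: ltW.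
have e2 : enorm q ^+ 2 = dotv q q by rewrite sqr_sqrtr// dotvv_ge0.
have [->|e0] := eqVneq (enorm q) 0; first by rewrite mul0r.
have {}e0 : 0 < enorm q by rewrite lt_def e0 sqrtr_ge0.
have qe : `|q| <= enorm q.
  by rewrite -ler_sqr ?nnegrE// ?(ltW e0)// e2 normv_sqr_le.
have := hq ((r / enorm q) *: q); rewrite dotvZr -e2.
have -> : r / enorm q * enorm q ^+ 2 = enorm q * r by field; lra.
apply; rewrite normrZ gtr0_norm ?divr_gt0// mulrAC ler_pdivrMr//.
by rewrite ler_pM2l.
Qed.

(** * Real thresholds, neighbourhoods and lower semicontinuity *)

Lemma lte_fin_between (c : R) (u : \bar R) : (c%:E < u)%E ->
  exists2 a, c < a & (a%:E < u)%E.
Proof.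
case: u => [u||]//; rewrite ?lte_fin => cu.
  by exists ((c + u) / 2); rewrite ?lte_fin; lra.
by exists (c + 1); rewrite ?ltry//; lra.
Qed.

Lemma lte_fin_le (u v : \bar R) : (u < v)%E ->
  exists2 b : R, (u <= b%:E)%E & (b%:E < v)%E.
Proof.
case: u v => [u||] [v||]// uv; first by exists u.
- by exists u; rewrite ?ltry.
- by exists (v - 1); rewrite ?leNye// lte_fin; lra.
- by exists 0; rewrite ?leNye ?ltry.
Qed.

Lemma nbhs_row_normP x (V : set 'rV[R]_n) : nbhs x V <->
  exists2 r : R, 0 < r & forall h, `|h| <= r -> V (x + h).
Proof.
split=> [/nbhs_ballP[r /= r0 rV]|[r r0 rV]].
  exists (r / 2) => [|h hr]; first by rewrite divr_gt0.
  apply: rV; rewrite -ball_normE /=.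
  by rewrite opprD addNKr normrN; lra.
apply/nbhs_ballP; exists r => //= y; rewrite -ball_normE /= => xy.
by have := rV (y - x); rewrite subrKC; apply; rewrite distrC ltW.
Qed.

Lemma lsc_norm f x (a : R) : lower_semicontinuous f -> (a%:E < f x)%E ->
  exists2 r : R, 0 < r & forall y, `|y - x| <= r -> (a%:E < f y)%E.
Proof.
move=> fl /fl[V /nbhs_row_normP[r r0 rV] Va]; exists r => // y yx.
by apply: Va; have := rV _ yx; rewrite subrKC.
Qed.

(** * Formal properties of the Legendre-Fenchel transform *)

Lemma legendre_ge f x y : ((dotv x y)%:E - f y <= legendre f x)%E.
Proof. by apply: ereal_sup_ubound; exists y. Qed.

Lemma legendre_le f x (u : \bar R) :
  (forall y, (dotv x y)%:E - f y <= u)%E -> (legendre f x <= u)%E.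
Proof. by move=> fu; apply: ge_ereal_sup => _ [y _ <-]. Qed.

(** A supremum of continuous affine functions: a [y] whose affine function exceeds [a] at [x] still
    does so nearby. *)
Lemma legendre_lsc f : lower_semicontinuous (legendre f).
Proof.
move=> x a /ereal_sup_gt[_ [y _ <-]].
have [fy|] := boolP (f y \is a fin_num); last first.
  (* If [f y = -oo], the transform is [+oo] everywhere; [f y = +oo] would put [a] below [-oo]. *)
  rewrite fin_numE negb_and !negbK => /orP[] /eqP fy.
    move=> _; exists setT => [|z _]; first exact: filterT.
    by apply: lt_le_trans (legendre_ge f z y); rewrite fy ltry.
  by rewrite fy ltNge leNye.
rewrite -(fineK fy) lte_fin => ay.
have N1 : 0 < n%:R * `|y| + 1 by rewrite ltr_pwDr// mulr_ge0.
pose d := dotv x y - fine (f y) - a; have d0 : 0 < d by rewrite subr_gt0.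
exists [set z | `|z - x| <= d / 2 / (n%:R * `|y| + 1)].
  apply/nbhs_row_normP; exists (d / 2 / (n%:R * `|y| + 1)) => [|h hr].
    by rewrite !divr_gt0.
  by rewrite /= addrC addKr.
move=> z /= zx; apply: lt_le_trans (legendre_ge f z y).
rewrite -(fineK fy) lte_fin.
have := dotv_le_norm (z - x) y; rewrite !dotvE ler_norml => /andP[h _].
move: zx; rewrite ler_pdivlMr// => zx; have := normr_ge0 (z - x).
by rewrite /d in zx d0; nra.
Qed.

(** Galois connection: for finite values both sides say [dotv x y <= f y + g x]. Applied to [g] and
    [legendre g], it bounds the biconjugate by [g]. *)
Lemma legendre_swap f g : (forall x, (legendre f x <= g x)%E) ->
  forall y, (legendre g y <= f y)%E.
Proof.
move=> fg y; apply: legendre_le => x; rewrite dotvC.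
have := le_trans (legendre_ge f x y) (fg x).
case: (f y) => [a||]; case: (g x) => [b||]//=;
  rewrite ?leey ?leNye// -?EFinD ?lee_fin; lra.
Qed.

(** * Convexity and the interior of the domain *)

Lemma convex_le g x y (t a b : R) : convex_efun g -> 0 <= t <= 1 ->
  (g x <= a%:E)%E -> (g y <= b%:E)%E ->
  (g (t *: x + (1 - t) *: y)%R <= (t * a + (1 - t) * b)%R%:E)%E.
Proof.
move=> gc /andP[t0 t1] xa yb; apply: le_trans (gc x y t t0 t1) _.
rewrite [leRHS]EFinD !EFinM; apply: leeD; apply: lee_wpmul2l => //.
by rewrite lee_fin subr_ge0.
Qed.

Lemma proper_fin g x (a : R) : proper_efun g -> (g x <= a%:E)%E ->
  exists2 b, g x = b%:E & b <= a.
Proof.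
move=> [/(_ x) + _]; case: (g x) => [b||]// _ ba.
by exists b => //; rewrite -lee_fin.
Qed.

(** The limsup is an infimum over neighbourhoods, so one of them has a supremum below [+oo]. With
    [bounded_idom], this describes [idom] by local upper bounds. *)
Lemma idom_bounded g x : idom g x ->
  exists M r : R, 0 < r /\ forall h, `|h| <= r -> (g (x + h)%R <= M%:E)%E.
Proof.
move=> [_ /ereal_inf_lt[_ [V Vx <-]]] Voo.
have [/= r r0 rV] := (nbhs_row_normP x V).1 Vx.
have [M VM] : exists M : R, (ereal_sup (g @` V) <= M%:E)%E.
  by case: (ereal_sup _) Voo => [M||]// _; [exists M | exists 0; rewrite leNye].
exists M, r; split => // h hr; apply: le_trans VM; apply: ereal_sup_ubound.
by exists (x + h) => //; exact: rV.
Qed.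

Lemma bounded_idom g x (M r : R) : proper_efun g -> 0 < r ->
  (forall h, `|h| <= r -> (g (x + h)%R <= M%:E)%E) -> idom g x.
Proof.
move=> gp r0 gM; split.
  have := gM 0; rewrite normr0 addr0 => /(_ (ltW r0)) /(proper_fin gp)[b gxb _].
  by rewrite /dom/= gxb ltNyr ltry.
apply: le_lt_trans (ltry M); apply: ge_ereal_inf.
exists (ereal_sup (g @` [set y | `|y - x| <= r])).
  exists [set y | `|y - x| <= r] => //; apply/nbhs_row_normP.
  by exists r => // h hr /=; rewrite addrC addKr.
by apply: ge_ereal_sup => _ [y /= yx <-]; have := gM _ yx; rewrite subrKC.
Qed.

(** The homothety of centre [w] and ratio [t] shrinks the ball around [x] where [g <= M] to one of
    radius [t * r], and convexity transports the bound. *)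
Lemma idom_segment g x w (b t : R) : convex_efun g -> proper_efun g ->
  idom g x -> (g w <= b%:E)%E -> 0 < t <= 1 -> idom g (t *: x + (1 - t) *: w).
Proof.
move=> gc gp /idom_bounded[M [r [r0 gM]]] wb /andP[t0 t1].
apply: (@bounded_idom _ _ (t * M + (1 - t) * b) (t * r)) => //.
  by rewrite mulr_gt0.
move=> h hr.
have -> : t *: x + (1 - t) *: w + h = t *: (x + t^-1 *: h) + (1 - t) *: w.
  by rewrite scalerDr scalerA divff ?gt_eqF// scale1r addrAC.
apply: convex_le => //; first by rewrite (ltW t0).
apply: gM; rewrite normrZ gtr0_norm ?invr_gt0//.
by rewrite mulrC ler_pdivrMr// mulrC.
Qed.

(** The segment from [x] to [z] can be prolonged a little inside [dom g]; then [z] is a point of the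
    longer segment other than its far end. *)
Lemma interior_dom_idom g x z : convex_efun g -> proper_efun g ->
  idom g x -> interior (dom g) z -> idom g z.
Proof.
move=> gc gp gx /nbhs_row_normP[r r0 rz].
(* The [+ 1] keeps the denominator positive even when [z = x]. *)
have N0 : 0 < `|z - x| + 1 by rewrite ltr_wpDl.
pose s := r / (`|z - x| + 1); have s0 : 0 < s by rewrite divr_gt0.
have /andP[_ wfin] : dom g (z + s *: (z - x)).
  apply: rz; rewrite normrZ (gtr0_norm s0) /s mulrAC ler_pdivrMr//.
  by rewrite ler_pM2l//; lra.
have [b wb] : exists b : R, (g (z + s *: (z - x))%R <= b%:E)%E.
  by case: (g _) wfin => [b||]// _; [exists b | exists 0; rewrite leNye].
have := @idom_segment g x _ b (s / (1 + s)) gc gp gx wb.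
have -> : s / (1 + s) *: x + (1 - s / (1 + s)) *: (z + s *: (z - x)) = z.
  apply/rowP => i; rewrite !mxE; field; lra.
apply; rewrite divr_gt0//=; last by lra.
by rewrite ler_pdivrMr; lra.
Qed.

(** * Gradients and subgradients *)

Lemma gradientE g x h : 'd (fine \o g) x h = dotv (gradient g x) h :> R.
Proof.
rewrite {1}(row_sum_delta h) linear_sum; apply: eq_bigr => i _.
by rewrite linearZ /= mxE mulrC.
Qed.

Lemma gradient_approx g x (e : R) : differentiable (fine \o g) x -> 0 < e ->
  exists2 r : R, 0 < r & forall h, `|h| <= r ->
    `|fine (g (x + h)) - fine (g x) - dotv (gradient g x) h| <= e * `|h|.
Proof.
move=> gd e0; have /eqaddoP/(_ _ e0)/nbhs_row_normP[r r0 rh] := diff_locally gd.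
exists r => // h /rh; rewrite add0r /=.
rewrite -[(_ + _ : _ -> _) _]/(_ + _) -![(- _ : _ -> _) _]/(- _) /cst /=.
by rewrite -gradientE// opprD addrA (addrC h).
Qed.

(** If the tangent at [x] exceeded [g w] by [d], convexity would put [g] at least [t * d] below the
    tangent after a step [t] towards [w], whereas differentiability allows only [t * d / 2] for
    small [t]. *)
Lemma gradient_subgradient g x w : convex_efun g -> proper_efun g ->
  idom g x -> differentiable (fine \o g) x ->
  ((fine (g x) + dotv (gradient g x) (w - x))%R%:E <= g w)%E.
Proof.
move=> gc gp gx gd; rewrite leNgt; apply/negP => gw.
have [b gwb _] := proper_fin gp (ltW gw).
have [a gxa] : exists a, g x = a%:E.
  have [M [r [/ltW r0 /(_ 0)]]] := idom_bounded gx.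
  by rewrite normr0 addr0 => /(_ r0) /(proper_fin gp)[a]; exists a.
move: gw; rewrite gwb gxa lte_fin /=; set D := dotv _ _ => baD.
have N0 : 0 < `|w - x| + 1 by rewrite ltr_wpDl.
pose d := a + D - b; have d0 : 0 < d by rewrite /d; lra.
pose e := d / 2 / (`|w - x| + 1); have e0 : 0 < e by rewrite !divr_gt0.
have ed : e * `|w - x| <= d / 2.
  by rewrite /e mulrAC ler_pdivrMr// ler_pM2l ?divr_gt0// lerDl.
have [r r0 gr] := gradient_approx gd e0.
pose t := Num.min 1 (r / (`|w - x| + 1)).
have t0 : 0 < t by rewrite lt_min ltr01 divr_gt0.
have t1 : t <= 1 by rewrite ge_min lexx.
have tr : `|t *: (w - x)| <= r.
  rewrite normrZ (gtr0_norm t0); apply: (@le_trans _ _ (t * (`|w - x| + 1))).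
    by rewrite ler_pM2l//; lra.
  by rewrite -ler_pdivlMr// ge_min lexx orbT.
have : (g (x + t *: (w - x))%R <= (t * b + (1 - t) * a)%R%:E)%E.
  have -> : x + t *: (w - x) = t *: w + (1 - t) *: x.
    by apply/rowP => i; rewrite !mxE; ring.
  by apply: convex_le; rewrite ?gwb ?gxa// (ltW t0).
move=> /(proper_fin gp)[c gc_ cle]; have := gr _ tr.
rewrite gc_ gxa /= dotvZr -/D normrZ (gtr0_norm t0) ler_norml => /andP[h _].
move: h; rewrite mulrCA /d in ed d0 *; nra.
Qed.

(** For small [h], comparing the subgradient inequality with the first-order expansion bounds
    [dotv h (p - gradient g z)] by [e * |h|]; duality then gives [|p - gradient g z| <= e] for every
    [e > 0]. *)
Lemma subgradient_unique g z p (s : R) : proper_efun g ->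
  idom g z -> differentiable (fine \o g) z ->
  g z = s%:E -> (forall w, ((s + dotv p (w - z))%R%:E <= g w)%E) ->
  gradient g z = p.
Proof.
move=> gp gz gd gzs sub.
have [M [r0 [r0_gt0 gM]]] := idom_bounded gz.
apply/eqP; rewrite -subr_eq0 -normr_eq0 eq_le normr_ge0 andbT.
apply/ler_addgt0Pl => e e0; rewrite addr0 -normrN opprB.
have [r r_gt0 gr] := gradient_approx gd e0.
apply: (normv_dual_le (r := Num.min r r0)) (ltW e0) _.
  by rewrite lt_min r_gt0.
move=> h; rewrite le_min => /andP[hr hr0].
have := sub (z + h); rewrite (addrC z h) addrK (addrC h z).
have [b gb _] := proper_fin gp (gM _ hr0).
have := gr _ hr; rewrite gb gzs /= lee_fin ler_norml => /andP[_ h1] h2.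
have h3 : e * `|h| <= e * Num.min r r0 by rewrite ler_pM2l// le_min hr.
by rewrite dotvDr dotvNr !(dotvC h); lra.
Qed.

(* The gradients along the segment from z to a point of idom g stay bounded,
   which essential smoothness forbids when z is a boundary point. *)
Lemma subgradient_idom g z p (s : R) : convex_efun g -> proper_efun g ->
  essentially_smooth g -> g z = s%:E ->
  (forall w, ((s + dotv p (w - z))%R%:E <= g w)%E) -> idom g z.
Proof.
move=> gc gp [[x gx] gd gb] gzs sub; apply: contrapT => Nz.
have [M [r [r0 gM]]] := idom_bounded gx.
have bz : boundary (dom g) z.
  split; last by move=> /(interior_dom_idom gc gp gx).
  by apply: subset_closure; rewrite /dom/= gzs ltNyr ltry.
clear Nz.
pose l (k : nat) : R := k.+1%:R^-1; pose u k := l k *: x + (1 - l k) *: z.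
have l0 k : 0 < l k by rewrite invr_gt0.
have l1 k : l k <= 1 by rewrite invf_le1 ?ler1n.
have uid k : idom g (u k).
  by apply: (@idom_segment _ _ _ s); rewrite ?gzs// l0 l1.
have uz : u k @[k --> \oo] --> z.
  have l_0 : l k @[k --> \oo] --> (0 : R) by exact: cvg_harmonic.
  rewrite -[X in _ --> X](_ : 0 *: x + (1 - 0) *: z = z); last first.
    by rewrite scale0r add0r subr0 scale1r.
  apply: cvgD; apply: cvgZr_tmp => //.
  by apply: cvgB => //; exact: cvg_cst.
(* The quotient will bound every gradient along [u]; the [+ 1] makes the contradiction strict. *)
have /cvgryPge/(_ ((M - s - dotv p (x - z)) / r + 1)) [N _] := gb u z uid bz uz.
move=> /(_ N (leqnn N)) /=; apply/negP; rewrite -ltNge ltr_pwDr//.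
rewrite ler_pdivlMr//; apply: enorm_dual_le => // h hr.
have guN := gradient_subgradient _ gc gp (uid N) (gd _ (uid N)).
have gu := gradient_subgradient (x + h) gc gp (uid N) (gd _ (uid N)).
have := sub (u N); have := guN z.
have [] : exists c, g (u N) = c%:E.
  have := uid N; rewrite /idom/dom/=; case: (g (u N)) => [c||]; case=> //.
  by exists c.
move=> c gc_; rewrite gc_ gzs !lee_fin /=.
have := le_trans (guN (x + h)) (gM _ hr); rewrite gc_ lee_fin /=.
have -> : u N = z + l N *: (x - z).
  by apply/rowP => i; rewrite !mxE; ring.
set G := gradient _ _; move: (l0 N) (l1 N); set t := l N => t0 t1.
have -> : x + h - (z + t *: (x - z)) = h + (1 - t) *: (x - z).
  by apply/rowP => i; rewrite !mxE; ring.
have -> : z - (z + t *: (x - z)) = (- t) *: (x - z).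
  by apply/rowP => i; rewrite !mxE; ring.
rewrite [z + _]addrC addrK dotvDr !dotvZr => h1 h2 h3.
(* Monotonicity of subgradients between [z] and [u N], the sum of [h2] and [h3]. Combined with [h1],
   it yields a bound free of [t]. *)
have h4 : dotv p (x - z) <= dotv G (x - z) by rewrite -(ler_pM2l t0); lra.
have h5 : (1 - t) * dotv p (x - z) <= (1 - t) * dotv G (x - z).
  by rewrite ler_wpM2l// subr_ge0.
lra.
Qed.

(** * Attained extrema: proximal points, and the supremum in the transform *)

(** Expand the square around [z]: the cross term is at least [- e], and the last term is
    nonnegative. *)
Lemma sqdist_near a z (e : R) : 0 < e ->
  exists2 r : R, 0 < r & forall w, `|w - z| <= r ->
    dotv (z - a) (z - a) - e <= dotv (w - a) (w - a).
Proof.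
move=> e0; have N0 : 0 < n%:R * `|z - a| + 1 by rewrite ltr_pwDr// mulr_ge0.
exists (e / 2 / (n%:R * `|z - a| + 1)) => [|w]; first by rewrite !divr_gt0.
rewrite ler_pdivlMr// => wz.
have -> : w - a = (z - a) + (w - z) by apply/rowP => i; rewrite !mxE; ring.
have := dotv_le_norm (z - a) (w - z); rewrite ler_norml => /andP[h _].
have := dotvv_ge0 (w - z); have := normr_ge0 (w - z); move: wz h N0.
move: (z - a) (w - z) => u v.
rewrite !dotvDl !dotvDr (dotvC v u).
set W := `|v|; set c := n%:R * `|u|.
move: (dotv u v) (dotv u u) (dotv v v) => A B C.
by rewrite mulrDr mulr1 (mulrC W); lra.
Qed.

(* m is the minimum of g + c/2 |. - a|^2, attained at z; the affine
   minorant makes this function coercive. *)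
Lemma prox_min g a q (al c : R) : lower_semicontinuous g -> proper_efun g ->
  0 < c -> (forall w, ((al + dotv q (w - a))%R%:E <= g w)%E) ->
  exists z (m : R), (g z <= (m - c / 2 * dotv (z - a) (z - a))%R%:E)%E /\
    forall w (r : R), (g w <= r%:E)%E -> m <= r + c / 2 * dotv (w - a) (w - a).
Proof.
move=> gl gp c0 aff.
pose sq w := dotv (w - a) (w - a).
(* The real upper bounds of the values of [g + c/2 |. - a|^2]; moving the quadratic to the right
   keeps the arithmetic in [R]. *)
pose S := [set v : R | exists w, (g w <= (v - c / 2 * sq w)%R%:E)%E].
have coer w (v : R) : (g w <= (v - c / 2 * sq w)%R%:E)%E ->
    al - dotv q q / c + c / 4 * sq w <= v.
  move=> gw; have := le_trans (aff w) gw; rewrite lee_fin /sq => {gw}.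
  (* Completing the square: [dotv q d] costs at most [dotv q q / c] plus half of the quadratic term,
     so [c / 4] survives. *)
  move: (w - a) => d; have := dotvv_ge0 (c^-1 *: q + 2^-1 *: d).
  rewrite !dotvE (dotvC d q).
  move: (dotv q q) (dotv q d) (dotv d d) => A B C h1 h2.
  have : 0 <= A / c + B + c / 4 * C.
    have -> : A / c + B + c / 4 * C =
      c * (c^-1 * (c^-1 * A) + c^-1 * (2^-1 * B) +
      (2^-1 * (c^-1 * B) + 2^-1 * (2^-1 * C))) by field; lra.
    by rewrite mulr_ge0 ?(ltW c0)//; lra.
  by lra.
have Slb v : S v -> al - dotv q q / c <= v.
  move=> [w /coer]; apply: le_trans; rewrite lerDl mulr_ge0 ?dotvv_ge0//.
  by rewrite divr_ge0// ltW.
have hS : has_inf S.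
  split; last by exists (al - dotv q q / c); apply: Slb.
  case: gp => g1 [w]; case gw: (g w) (g1 w) => [b||]// _ _.
  by exists (b + c / 2 * sq w), w; rewrite gw addrK.
pose m := inf S.
have /choice[u uP] (k : nat) : exists w,
    (g w <= (m + k.+1%:R^-1 - c / 2 * sq w)%R%:E)%E.
  have [|v [w gw] vm] := @inf_adherent _ S k.+1%:R^-1 _ hS.
    by rewrite invr_gt0.
  by exists w; apply: le_trans gw _; rewrite lee_fin lerD2r ltW.
pose B := (m + 1 - al + dotv q q / c) * 4 / c.
have uB k : sq (u k) <= B.
  have := coer _ _ (uP k).
  have : (k.+1%:R^-1 : R) <= 1 by rewrite invf_le1 ?ler1n.
  move=> h1 h2; rewrite /B ler_pdivlMr//.
  by move: (k.+1%:R^-1) (sq (u k)) (dotv q q / c) h1 h2 => Y X Z; lra.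
(* A number whose square is at most [B] is itself at most [B + 1]. *)
have Kc : compact (closed_ball_ (fun w : 'rV[R]_n => `|w|) a (B + 1)).
  apply: bounded_closed_compact; last exact: closed_closed_ball_.
  exists (B + 1 + `|a|); split; first by rewrite num_real.
  move=> M MB w; rewrite /closed_ball_ /= distrC => wa.
  rewrite -(subrK a w) (le_trans (ler_normD _ _))//.
  by apply: le_trans (ltW MB); rewrite lerD2r.
have uK k : `|a - u k| <= B + 1.
  rewrite distrC.
  have := normv_sqr_le (u k - a); have := uB k; rewrite /sq.
  have := normr_ge0 (u k - a); nra.
have [|z [_ zcl]] := Kc (u @ \oo) _; first by exists 0%N => // k _; exact: uK.
exists z, m; split; last first.
  move=> w r gw; apply: ge_inf; first by have [] := hS.
  by exists w; rewrite addrK.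
rewrite leNgt; apply/negP => /lte_fin_between[b mb bz].
(* Half of the gap [e] pays for the variation of the quadratic term, through [c / 2 * (e / c)], and
   half for the defect [1 / (k + 1)]. *)
pose e := b - (m - c / 2 * sq z); have e0 : 0 < e by rewrite subr_gt0.
have [r1 r1_gt0 zr1] := lsc_norm gl bz.
have [r2 r2_gt0 zr2] := sqdist_near a z (divr_gt0 e0 c0).
have [N _ Ne] : \forall k \near \oo, (k.+1%:R^-1 : R) < e / 2.
  have : (k.+1%:R^-1 : R) @[k --> \oo] --> (0 : R) by exact: cvg_harmonic.
  by move/cvgr_lt; apply; rewrite divr_gt0.
pose V := [set w : 'rV[R]_n | `|w - z| <= Num.min r1 r2].
have Vz : nbhs z V.
  apply/nbhs_row_normP; exists (Num.min r1 r2) => [|h hr].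
    by rewrite lt_min r1_gt0.
  by rewrite /V /= addrC addKr.
have [|_ [[k /= Nk <-]]] := zcl (u @` [set k | (N <= k)%N]) V _ Vz.
  by exists N => // k Nk; exists k.
rewrite /V /= le_min => /andP[/zr1 ub /zr2].
have := lt_le_trans ub (uP k); rewrite lte_fin.
have /= := Ne k Nk; rewrite -/(sq _) -/(sq _) => h1 h2 h3.
have : c / 2 * (sq z - e / c) <= c / 2 * sq (u k) by rewrite ler_pM2l ?divr_gt0.
have -> : c / 2 * (sq z - e / c) = c / 2 * sq z - e / 2 by field; lra.
move: h1 h2 h3; rewrite -/(sq _) -/(sq _) => h1 h2 _ h4.
have : e = b - (m - c / 2 * sq z) by [].
by move: (k.+1%:R^-1) h1 h2 h4 => Y; lra.
Qed.

(** First-order optimality at the minimiser [z]: moving by [t] towards [w] changes the quadratic by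
    [- t * dotv (c *: (a - z)) (w - z)] plus a term of order [t^2]. *)
Lemma prox g a q (al c : R) : convex_efun g ->
  lower_semicontinuous g -> proper_efun g ->
  0 < c -> (forall w, ((al + dotv q (w - a))%R%:E <= g w)%E) ->
  exists z (s : R), g z = s%:E /\
    forall w, ((s + dotv (c *: (a - z)) (w - z))%R%:E <= g w)%E.
Proof.
move=> gc gl gp c0 aff; have [z [m [gz mle]]] := prox_min gl gp c0 aff.
have [s gzs sm] := proper_fin gp gz; exists z, s; split=> // w.
have ms := mle z s; rewrite gzs lexx in ms; have {}ms := ms isT.
rewrite leNgt; apply/negP => gw; have [b gwb _] := proper_fin gp (ltW gw).
move: gw; rewrite gwb lte_fin; set D := dotv _ _ => bD.
pose d := s + D - b; have d0 : 0 < d by rewrite /d; lra.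
pose Q := c * dotv (w - z) (w - z).
have Q0 : 0 <= Q by rewrite mulr_ge0 ?dotvv_ge0// ltW.
(* This [t] satisfies [t * Q <= d], so the second-order term [t^2 Q / 2] cannot compensate the
   first-order gain [t * d]. *)
pose t := d / (d + Q).
have dQ : 0 < d + Q by rewrite ltr_wpDr.
have t0 : 0 < t by rewrite divr_gt0.
have t1 : t <= 1 by rewrite ler_pdivrMr// mul1r lerDl.
have tQ : t * Q <= d.
  by rewrite /t mulrAC ler_pdivrMr// mulrDr lerDr mulr_ge0// ltW.
have : m <= t * b + (1 - t) * s + c / 2 *
    dotv (t *: w + (1 - t) *: z - a) (t *: w + (1 - t) *: z - a).
  by apply: mle; apply: convex_le; rewrite ?gwb ?gzs// (ltW t0).
have -> : t *: w + (1 - t) *: z - a = (z - a) + t *: (w - z).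
  by apply/rowP => i; rewrite !mxE; ring.
rewrite !(dotvDl (z - a)) !(dotvDr _ (z - a)) !dotvZl !dotvZr.
rewrite (dotvC (w - z) (z - a)) => h.
have DE : D = - c * dotv (z - a) (w - z).
  by rewrite /D dotvZl -(opprB z a) dotvNl mulNr mulrN.
have {}h : t * d <= t * (t * Q / 2).
  have sm' : s = m - c / 2 * dotv (z - a) (z - a).
    by apply/eqP; rewrite eq_le sm; lra.
  by move: h; rewrite /d DE /Q; nra.
by move: h; rewrite ler_pM2l//; lra.
Qed.

(* Near-maximisers y of <x, y> - f y converge to the gradient of g at x. *)
Lemma legendre_attained f g x : lower_semicontinuous f -> proper_efun g ->
  idom g x -> differentiable (fine \o g) x ->
  (forall w, (legendre f w <= g w)%E) -> legendre f x = g x ->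
  (f (gradient g x) <= (dotv x (gradient g x) - fine (g x))%R%:E)%E.
Proof.
move=> fl gp gx gd fg fgx; rewrite leNgt; apply/negP => /lte_fin_between[a].
set y0 := gradient g x => ca /(lsc_norm fl)[r1 r1_gt0 fr].
have [M [r0 [r0_gt0 gM]]] := idom_bounded gx.
have [k gxk] : exists k, g x = k%:E.
  have := gM 0; rewrite normr0 addr0 => /(_ (ltW r0_gt0)).
  by move=> /(proper_fin gp)[k]; exists k.
rewrite gxk /= in ca.
pose dl := a - (dotv x y0 - k); have dl0 : 0 < dl by rewrite subr_gt0.
have N0 : 0 < n%:R * `|x| + 1 by rewrite ltr_pwDr// mulr_ge0.
(* Since [|y - y0| <= 2 e] below, the first bound keeps [y] where [f > a], and the second keeps
   [dotv x (y - y0)] at most [dl / 2]. The other [dl / 2] is left to the defect [e']. *)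
pose e := Num.min (r1 / 2) (dl / 4 / (n%:R * `|x| + 1)).
have e0 : 0 < e by rewrite lt_min !divr_gt0.
have er1 : e * 2 <= r1 by rewrite -ler_pdivlMr// ge_min lexx.
have edl : e * (n%:R * `|x| + 1) <= dl / 4.
  by rewrite -ler_pdivlMr// ge_min lexx orbT.
have [r2 r2_gt0 gr] := gradient_approx gd e0.
pose r := Num.min r0 r2; have r_gt0 : 0 < r by rewrite lt_min r0_gt0.
pose e' := Num.min (e * r) (dl / 2).
have e'0 : 0 < e' by rewrite lt_min mulr_gt0//= divr_gt0.
have : ((k - e')%R%:E < legendre f x)%E by rewrite fgx gxk lte_fin; lra.
move=> /ereal_sup_gt[_ [y _ <-]].
have := legendre_ge f x y; rewrite fgx gxk.
case fy : (f y) => [v||]//= _; rewrite lte_fin => h1.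
have yy : `|y - y0| <= e * 2.
  apply: (normv_dual_le r_gt0); first by rewrite mulr_ge0// ltW.
  (* Near-maximality at [x], the bound [f^* <= g] at [x + h] and the expansion of [g] give
     [dotv h (y - y0) <= e * |h| + e' <= 2 e r]. *)
  move=> h hr; have /andP[hr0 hr2] : (`|h| <= r0) && (`|h| <= r2).
    by rewrite -le_min.
  have [b gb _] := proper_fin gp (gM _ hr0).
  have := le_trans (legendre_ge f (x + h) y) (fg (x + h)).
  rewrite fy gb lee_fin dotvDl => h2.
  have := gr _ hr2; rewrite gb gxk /= ler_norml => /andP[_ h3].
  have h4 : e * `|h| <= e * r by rewrite ler_pM2l.
  have h5 : e' <= e * r by rewrite ge_min lexx.
  by rewrite dotvDr dotvNr (dotvC h y0); lra.
have := fr _ (le_trans yy er1); rewrite fy lte_fin => av.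
have := dotv_le_norm x (y - y0); rewrite ler_norml => /andP[_].
have : n%:R * `|x| * `|y - y0| <= n%:R * `|x| * (e * 2).
  by rewrite ler_wpM2l// mulr_ge0.
have : e' <= dl / 2 by rewrite ge_min lexx orbT.
rewrite dotvDr dotvNr /dl in edl *.
by move: edl; rewrite mulrDr mulr1 (mulrC e); lra.
Qed.

(** * Recovering a function from its conjugate *)

(** A tangent at a point of [idom g], recentred at [a] as [prox] requires; its slope is the same for
    all centres. *)
Lemma affine_minorant g : convex_efun g -> proper_efun g ->
  essentially_smooth g ->
  exists q, forall a, exists al : R,
    forall w, ((al + dotv q (w - a))%R%:E <= g w)%E.
Proof.
move=> gc gp [[x gx] gd _]; exists (gradient g x) => a.
exists (fine (g x) + dotv (gradient g x) (a - x)) => w.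
have := gradient_subgradient w gc gp gx (gd _ gx).
congr (_%:E <= _)%E; rewrite -addrA -dotvDr; congr (_ + dotv _ _).
by rewrite [RHS]addrC subrKA.
Qed.

Lemma le_legendre f g : lower_semicontinuous g -> proper_efun g ->
  convex_efun g -> essentially_smooth g -> lower_semicontinuous f ->
  (forall x, (legendre f x <= g x)%E) ->
  (forall x, idom g x -> legendre f x = g x) ->
  forall y, (f y <= legendre g y)%E.
Proof.
move=> gl gp gc gs fl fg fgE y; rewrite leNgt; apply/negP.
have [[x0 gx0] gd _] := gs; have [q aff] := affine_minorant gc gp gs.
have [g0 gx0E] : exists g0 : R, g x0 = g0%:E.
  have [/andP[]] := gx0; case: (g x0) => [g0||]//; by exists g0.
have := legendre_ge g y x0; rewrite gx0E.
case gy : (legendre g y) => [b||]//; rewrite ?lee_fin => K0; last first.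
  by rewrite ltNge leey.
move=> /(lsc_norm fl)[r r0 fr].
(* For [e <= 1], [K] bounds [e * dotv z z], by the subgradient inequality at [x0] and
   [dotv y z - g z <= b]. Hence [|e z|^2 <= e * K <= r^2]. The [+ 1] makes [K] positive. *)
pose K := 2 * (g0 - dotv y x0 + b) + dotv x0 x0 + 1.
have K_gt0 : 0 < K by have := dotvv_ge0 x0; rewrite /K; lra.
pose e := Num.min 1 (r ^+ 2 / K).
have e0 : 0 < e by rewrite lt_min ltr01 divr_gt0// exprn_gt0.
have e1 : e <= 1 by rewrite ge_min lexx.
have eK : e * K <= r ^+ 2 by rewrite -ler_pdivlMr// ge_min lexx orbT.
(* With centre [e^-1 *: y] and weight [e], the penalty is [e/2 |w|^2 - dotv w y] up to a
   constant. *)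
have [al affe] := aff (e^-1 *: y).
have [z [s [gz sub]]] := prox gc gl gp e0 affe.
have pE : e *: (e^-1 *: y - z) = y - e *: z.
  by rewrite scalerBr scalerA divff ?gt_eqF// scale1r.
rewrite pE in sub.
have zid := subgradient_idom gc gp gs gz sub.
have gradz := subgradient_unique gp zid (gd _ zid) gz sub.
have := legendre_attained fl gp zid (gd _ zid) fg (fgE _ zid).
rewrite gradz gz /=.
have b1 := legendre_ge g y z; rewrite gy gz lee_fin in b1.
have b2 := sub x0; rewrite gx0E lee_fin in b2.
have zz := dotvv_ge0 z; have b3 := dotv_le_half z x0.
move=> le1; have : (f (y - e *: z)%R <= b%:E)%E.
  apply: le_trans le1 _; rewrite lee_fin dotvDr dotvNr dotvZr (dotvC z y).
  have : 0 <= e * dotv z z by rewrite mulr_ge0// ltW.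
  by lra.
apply/negP; rewrite -ltNge; apply: fr.
rewrite addrC addKr normrN.
rewrite -ler_sqr ?nnegrE ?(ltW r0)//.
apply: le_trans (normv_sqr_le _) _; apply: le_trans eK.
rewrite dotvZl dotvZr ler_pM2l//.
rewrite !dotvE in b2.
have h1 : e * dotv z x0 <= e * ((dotv z z + dotv x0 x0) / 2).
  by rewrite ler_pM2l.
have h2 : e * dotv x0 x0 <= dotv x0 x0 by rewrite ler_piMl// dotvv_ge0.
by rewrite /K; lra.
Qed.

(** If the biconjugate at [x] were at most [b < g x], the affine minorant touching [g] at a proximal
    point [z] of [x] would already exceed [b] at [x]. *)
Lemma legendre_involutive g : lower_semicontinuous g -> proper_efun g ->
  convex_efun g -> essentially_smooth g -> legendre (legendre g) = g.
Proof.
move=> gl gp gc gs; apply/funext => x; apply/eqP.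
rewrite eq_le legendre_swap//= leNgt; apply/negP.
have [q /(_ x)[al aff]] := affine_minorant gc gp gs.
move=> /lte_fin_le[b lb bg]; have [r r0 gr] := lsc_norm gl bg.
have A0 := normr_ge0 (b - al + dotv q q / 2).
(* The [2^-1] absorbs the quadratic loss in bounding [dotv q (z - x)]; the rest makes
   [(c - 2^-1) * r^2] exceed [b - al + dotv q q / 2], which excludes [|z - x| > r]. *)
pose c := 1 + `|b - al + dotv q q / 2| / r ^+ 2 + 2^-1.
have r2 : 0 < r ^+ 2 by rewrite exprn_gt0.
have c0 : 0 < c by have := divr_ge0 A0 (ltW r2); rewrite /c; lra.
have [z [s [gz sub]]] := prox gc gl gp c0 aff.
set p := c *: (x - z) in sub.
(* The subgradient inequality says that [w = z] maximises [dotv p w - g w]. *)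
have lp : (legendre g p <= (dotv p z - s)%R%:E)%E.
  apply: legendre_le => w; move: (sub w); case: (g w) => [v||]//.
    by rewrite !lee_fin dotvDr dotvNr; lra.
  by rewrite leNye.
have {}lb : s + c * dotv (z - x) (z - x) <= b.
  rewrite -lee_fin; apply: le_trans lb; apply: le_trans (legendre_ge _ x p).
  have -> : s + c * dotv (z - x) (z - x) = dotv x p - (dotv p z - s).
    rewrite /p !dotvE (dotvC z x).
    by ring.
  by rewrite EFinB; apply: leeB.
have zx0 := dotvv_ge0 (z - x); have czx := mulr_ge0 (ltW c0) zx0.
have [/gr|rz] := leP `|z - x| r; first by rewrite gz lte_fin; lra.
have rzx : r ^+ 2 <= dotv (z - x) (z - x).
  apply: le_trans (normv_sqr_le _).
  by rewrite ler_sqr ?nnegrE ?(ltW r0)// ltW.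
have := aff z; rewrite gz lee_fin => h1.
have := dotv_le_half (- q) (z - x); rewrite !(dotvNl, dotvNr) opprK => h2.
have h3 : (1 + `|b - al + dotv q q / 2| / r ^+ 2) * r ^+ 2 <=
    (c - 2^-1) * dotv (z - x) (z - x).
  by rewrite /c addrK ler_pM2l// ltr_pwDl// divr_ge0// ltW.
rewrite mulrDl mul1r divfK ?gt_eqF// in h3.
have := ler_norm (b - al + dotv q q / 2); lra.
Qed.

End LegendreFenchel.

Theorem corollary6p4 (R : realType) (n : nat) (g : 'rV[R]_n -> \bar R)
    (g_lsc : lower_semicontinuous g) (g_proper : proper_efun g)
    (g_convex : convex_efun g) (g_smooth : essentially_smooth g) :
  (forall f : 'rV[R]_n -> \bar R,
     lower_semicontinuous f ->
     (forall x, (legendre f x <= g x)%E) ->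
     (forall x, idom g x -> legendre f x = g x) ->
     f = legendre g) /\
  (exists! f : 'rV[R]_n -> \bar R,
     lower_semicontinuous f /\ legendre f = g).
Proof.
(* This serves twice: as the first claim and, when [legendre f = g] everywhere, as uniqueness of the
   preimage. *)
have gE f : lower_semicontinuous f -> (forall x, (legendre f x <= g x)%E) ->
    (forall x, idom g x -> legendre f x = g x) -> f = legendre g.
  move=> fl fg fgE; apply/funext => y; apply/eqP; rewrite eq_le.
  by rewrite legendre_swap// le_legendre.
split=> //; exists (legendre g); split.
  by split; [exact: legendre_lsc | exact: legendre_involutive].
by move=> f [fl fg]; apply/esym/gE => // x; rewrite fg.
Qed.
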